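(* Let $L$ be a simple finite-dimensional Lie algebra over a field of characteristic $0$. Then the Lie-orthogonal operators on $L$ are exactly the trivial operators $\mathrm{Id}_L$ and $-\mathrm{Id}_L$.
   Context: A linear operator $J$ on a Lie algebra $L$ is called Lie-orthogonal if $[Jx,Jy]=[x,y]$ for all $x,y\in L$. $\mathrm{Id}_L$ denotes the identity operator on $L$. *)

(* Defs.v *)
From HB Require Import structures.
From mathcomp Require Import all_boot all_order all_algebra.

Set Implicit Arguments.
Unset Strict Implicit.
Unset Printing Implicit Defensive.

Import GRing.Theory.
Local Open Scope ring_scope.

HB.mixin Record Lmodule_isLieAlgebra (R : comNzRingType) (L : Type)
    of GRing.Lmodule R L := {
  lie_bracket : L -> L -> L;
  lie_bilinear : bilinear_for *:%R *:%R lie_bracket;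
  lie_alternating : forall x, lie_bracket x x = 0;
  lie_jacobi : forall x y z,
    lie_bracket x (lie_bracket y z) + lie_bracket y (lie_bracket z x)
      + lie_bracket z (lie_bracket x y) = 0
}.

#[short(type="lieAlgType")]
HB.structure Definition LieAlgebra (R : comNzRingType) :=
  { L of Lmodule_isLieAlgebra R L & GRing.Lmodule R L }.

#[short(type="findimLieAlgType")]
HB.structure Definition FindimLieAlgebra (R : comNzRingType) :=
  { L of Lmodule_isLieAlgebra R L & Vector R L }.

Notation "[ 'lie' x , y ]" := (lie_bracket x y)
  (at level 0, x, y at level 99, format "[ 'lie'  x ,  y ]") : ring_scope.

Definition lie_abelian (R : comNzRingType) (L : lieAlgType R) : Prop :=
  forall x y : L, [lie x, y] = 0.

(* By antisymmetry of the bracket, left and right ideals coincide. *)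
Definition lie_ideal (F : fieldType) (L : findimLieAlgType F)
    (I : {vspace L}) : Prop :=
  forall x y : L, y \in I -> [lie x, y] \in I.

Definition lie_simple (F : fieldType) (L : findimLieAlgType F) : Prop :=
  ~ lie_abelian L /\
  forall I : {vspace L}, lie_ideal I -> I = 0%VS \/ I = fullv.

Definition lie_orthogonal (F : fieldType) (L : findimLieAlgType F)
    (J : 'End(L)) : Prop :=
  forall x y : L, [lie J x, J y] = [lie x, y].

(* Main.v *)
(** The heart is that a finite-dimensional simple Lie algebra L of characteristic 0
    carries a nondegenerate invariant form B. Put tau(x, y, z) = B(x, [y, z]), an
    alternating form. If J is Lie-orthogonal then inserting J in any two slots of
    tau does not change it, so tau(Jx, J^2 u, Jz) = tau(x, Ju, Jz) = tau(x, u, z)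
    = tau(Jx, u, Jz); as J is bijective, J^2 = 1. Then the fixed space of J is an
    ideal, so it is 0 or L, that is J = -1 or J = 1.

    The form B is the Killing form. It is nonzero by the following proof of Cartan's
    criterion. Suppose B = 0 and let s be the eigenvalues of M = ad x over a
    splitting field. If M is not nilpotent there is a Q-linear map c from the
    Q-span of the s_i to Q with some c(s_i) <> 0. The polynomial d = f(M) acting as c(s_i)
    on the generalized eigenspace of s_i is a derivation, because brackets add
    generalized eigenvalues. As L is perfect and B = 0, tr(M d) = 0, that is
    sum s_i c(s_i) = 0; applying c gives sum c(s_i)^2 = 0, a contradiction. So all
    ad x are nilpotent, and Engel's theorem gives L a nonzero center. *)

Require Import Defs.
From HB Require Import structures.
From mathcomp Require Import all_boot all_order all_algebra all_field.
From mathcomp Require Import ring.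
From Stdlib Require Import Classical.

Set Implicit Arguments.
Unset Strict Implicit.
Unset Printing Implicit Defensive.

Import Order.TTheory GRing.Theory Num.Theory.
Local Open Scope ring_scope.

(** * Rational numbers and rational functionals in characteristic 0 *)

Lemma char0_intr_eq0 (K : fieldType) (z : int) :
  [pchar K] =i pred0 -> (z%:~R == 0 :> K) = (z == 0).
Proof.
move=> /pcharf0P K0; rewrite -[z]intz; case: (intP z) => [|n|n].
- by rewrite mulr0z eqxx.
- by rewrite intz -pmulrn K0.
- by rewrite intz rmorphN /= oppr_eq0 -pmulrn K0 oppr_eq0.
Qed.

Section RatEmbedding.
Variables (K : fieldType) (K0 : [pchar K] =i pred0).

(** [ratr] reads the reduced fraction of its argument, while the natural fractions for sums and
    products are not reduced; cross-multiplying in the integers reconciles the two. *)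
Lemma char0_ratr_div (a b : int) : b != 0 ->
  ratr (a%:~R / b%:~R) = a%:~R / b%:~R :> K.
Proof.
move=> b0; set x : rat := _ / _.
have xE : x * b%:~R = a%:~R by rewrite /x divfK // intr_eq0.
have E : numq x * b = a * denq x.
  apply: (@intr_inj rat); rewrite !rmorphM /= -xE {1}numqE; ring.
have d0 : (denq x)%:~R != 0 :> K by rewrite char0_intr_eq0 // denq_neq0.
have b0' : b%:~R != 0 :> K by rewrite char0_intr_eq0.
by rewrite /ratr; apply/eqP; rewrite eqr_div // -!rmorphM E.
Qed.

Lemma char0_ratrD : {morph (ratr : rat -> K) : x y / x + y}.
Proof.
move=> x y; have nz z : (denq z)%:~R != 0 :> K by rewrite char0_intr_eq0 ?denq_neq0.
have nzq z : (denq z)%:~R != 0 :> rat by rewrite intr_eq0 denq_neq0.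
rewrite -{1}[x]divq_num_den -{1}[y]divq_num_den addf_div // -!rmorphM -rmorphD /=.
by rewrite char0_ratr_div ?mulf_neq0 ?denq_neq0 // /ratr addf_div // rmorphD !rmorphM.
Qed.

Lemma char0_ratrM : {morph (ratr : rat -> K) : x y / x * y}.
Proof.
move=> x y; rewrite -{1}[x]divq_num_den -{1}[y]divq_num_den mulf_div -!rmorphM /=.
by rewrite char0_ratr_div ?mulf_neq0 ?denq_neq0 // /ratr mulf_div !rmorphM.
Qed.
End RatEmbedding.

(** Starting from 0, adjoin a vector of [P] outside [U] as long as one exists, which excluded middle
    decides; the dimension bounds the number of rounds. Subspaces can thus be given by undecidable
    properties. *)
Lemma vspace_of_pred (F : fieldType) (V : vectType F) (P : V -> Prop) :
    P 0 -> (forall a u v, P u -> P v -> P (a *: u + v)) ->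
  exists U : {vspace V}, forall v, v \in U <-> P v.
Proof.
move=> P0 Plin; suff ext k (U : {vspace V}) : (\dim {:V} - \dim U <= k)%N ->
    (forall v, v \in U -> P v) -> exists W : {vspace V}, forall v, v \in W <-> P v.
  by apply: (ext _ 0%VS (leqnn _)) => v /vlineP[a ->]; rewrite scaler0.
elim: k U => [|k IH] U leUk UP.
  exists U => v; split=> [/UP//|_]; suff -> : U = fullv by apply: memvf.
  by apply/eqP; rewrite eqEdim subvf /= -subn_eq0 -leqn0.
have [[v [Pv nUv]]|noext] := classic (exists v, P v /\ v \notin U); last first.
  exists U => v; split=> [/UP//|Pv]; apply: contra_notT noext => nUv.
  by exists v.
apply: (IH (<[v]> + U)%VS) => [|w].
  have lt : (\dim U < \dim (<[v]> + U))%N.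
    rewrite (ltn_leqif (dimv_leqif_eq (addvSr _ _))); apply/eqP => UE.
    by case/negP: nUv; rewrite UE memvE addvSl.
  have le : (\dim (<[v]> + U) <= \dim {:V})%N by rewrite dimvS ?subvf.
  by rewrite -ltnS (leq_trans _ leUk) // ltn_sub2l // (leq_trans lt).
by case/memv_addP=> x /vlineP[a ->] [y /UP Py ->]; apply: Plin.
Qed.

(** The [c i] are the values on the [s i] of a Q-linear map from their Q-span to Q. The rational
    relations among the [s i] form a subspace [U]; each coordinate of [q - projv U q] vanishes on
    [U], and one of them is nonzero at the basis vector of index [i0], since [s i0 != 0] keeps that
    vector out of [U]. *)
Lemma rat_functional (K : fieldType) (K0 : [pchar K] =i pred0) n
    (s : 'I_n -> K) (i0 : 'I_n) : s i0 != 0 ->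
  exists c : 'I_n -> rat, c i0 != 0 /\
    forall q : 'I_n -> rat, \sum_i ratr (q i) * s i = 0 -> \sum_i q i * c i = 0.
Proof.
move=> si0; have [||U UP] := @vspace_of_pred _ 'rV[rat]_n
    (fun q => \sum_i ratr (q 0 i) * s i = 0).
- by apply: big1 => i _; rewrite mxE /ratr mul0r mul0r.
- move=> a u v u0 v0.
  transitivity (ratr a * (\sum_i ratr (u 0 i) * s i) + \sum_i ratr (v 0 i) * s i).
    rewrite mulr_sumr -big_split; apply: eq_bigr => i _.
    by rewrite !mxE char0_ratrD // char0_ratrM // mulrDl mulrA.
  by rewrite u0 v0 mulr0 addr0.
pose e i : 'rV[rat]_n := delta_mx 0 i.
pose f (q : 'rV[rat]_n) := q - projv U q.
have fU q : q \in U -> f q = 0 by move=> /projv_id; rewrite /f => ->; rewrite subrr.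
have [j fj] : exists j, f (e i0) 0 j != 0.
  apply: NNPP => nj; have e_U : e i0 \in U.
    have -> : e i0 = projv U (e i0); last exact: memv_proj.
    apply/eqP; rewrite -subr_eq0; apply/eqP/rowP => j; rewrite [RHS]mxE.
    by apply/eqP/negPn/negP => fj; apply: nj; exists j.
  have := (UP (e i0)).1 e_U; rewrite (bigD1 i0) //= big1 => [|i ne].
    by rewrite mxE !eqxx ratr_nat mul1r addr0 => /eqP; rewrite (negPf si0).
  by rewrite mxE (negPf ne) andbF /ratr mul0r mul0r.
exists (fun i => f (e i) 0 j); split=> // q q0.
pose r := \row_i q i; have /fU : r \in U.
  by apply: (UP r).2; rewrite -[RHS]q0; apply: eq_bigr => i _; rewrite mxE.
move=> fr0; transitivity (f r 0 j); last by rewrite fr0 mxE.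
rewrite /f [in RHS](row_sum_delta r) linear_sum -sumrB summxE.
by apply: eq_bigr => i _; rewrite linearZ /= -scalerBr [RHS]mxE [r 0 i]mxE.
Qed.

(** * Splitting fields and triangular form *)

Lemma exists_irreducible_dvdp (F : fieldType) (p : {poly F}) :
  (1 < size p)%N -> exists2 r, irreducible_poly r & r %| p.
Proof.
elim: {p}(size p) {-2}p (leqnn (size p)) => [|n IH] p; first by case: (size p).
move=> le_p p1; have [irr|] := classic (irreducible_poly p); first by exists p.
move=> nirr.
have [q [q1 qp nqp]] : exists q : {poly F}, [/\ size q != 1, q %| p & ~~ (q %= p)].
  apply: NNPP => nq; apply: nirr; split=> // q q1 qp.
  by apply/negPn/negP => nqp; apply: nq; exists q.
have p0 : p != 0 by rewrite -size_poly_gt0 (ltn_trans _ p1).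
have q0 : q != 0 by rewrite (dvdpN0 qp).
have [||r irr rq] := IH q; last by exists r; rewrite ?(dvdp_trans rq).
  rewrite -ltnS (leq_trans _ le_p) // ltn_neqAle dvdp_leq // andbT.
  by rewrite dvdp_size_eqp.
by rewrite ltn_neqAle eq_sym q1 size_poly_gt0.
Qed.

(** Adjoin a root of an irreducible factor, divide by the linear factor and recurse on the degree;
    the base field changes along the induction. *)
Lemma exists_splitting_field (F : fieldType) (p : {poly F}) : p \is monic ->
  exists (K : fieldType) (f : {rmorphism F -> K}) (s : seq K),
    map_poly f p = \prod_(z <- s) ('X - z%:P).
Proof.
have [n] := ubnP (size p); elim: n => // n IH in F p * => le_p mon_p.
have [p1|p1] := leqP (size p) 1.
  exists F, idfun, [::]; rewrite big_nil map_poly_id //.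
  by move: mon_p; rewrite (size1_polyC p1) monicE lead_coefC => /eqP ->.
have [r irr rp] := exists_irreducible_dvdp p1.
have [K _ [z rz _]] := irredp_FAdjoin irr.
have : root (map_poly (in_alg K) p) z.
  by rewrite -(divpK rp) rmorphM rootM rz orbT.
case/factor_theorem=> q qE.
have mon_q : q \is monic.
  by rewrite -(monicMr _ (monicXsubC z)) -qE map_monic.
have [|E [f [s fs]]] := IH K q _ mon_q.
  have := size_map_poly (in_alg K) p.
  rewrite qE size_Mmonic ?monic_neq0 ?monicXsubC // size_XsubC addn2 /= => sz.
  by rewrite sz.
exists E, (f \o in_alg K), (f z :: s).
rewrite map_poly_comp qE rmorphM /= fs big_cons mulrC; congr (_ * _).
by rewrite rmorphB /= map_polyX map_polyC.
Qed.

Lemma char_poly_conj (K : fieldType) n (P M : 'M[K]_n) : P \in unitmx ->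
  char_poly (P *m M *m invmx P) = char_poly M.
Proof.
move=> Pu; rewrite /char_poly /char_poly_mx !map_mxM /=.
set Q := map_mx polyC P; set Q' := map_mx polyC (invmx P).
have QQ' : Q *m Q' = 1%:M by rewrite -map_mxM mulmxV // map_mx1.
have -> : 'X%:M - Q *m map_mx polyC M *m Q' = Q *m ('X%:M - map_mx polyC M) *m Q'.
  by rewrite mulmxBr mulmxBl mul_mx_scalar -scalemxAl QQ' scalemx1.
by rewrite !det_mulmx mulrAC -det_mulmx QQ' det1 mul1r.
Qed.

Lemma char_poly_lblock (R : comNzRingType) m n (A : 'M[R]_m) (B : 'M[R]_(n, m)) C :
  char_poly (block_mx A 0 B C) = char_poly A * char_poly C.
Proof.
rewrite /char_poly /char_poly_mx map_block_mx scalar_mx_block opp_block_mx.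
by rewrite add_block_mx map_mx0 subr0 det_lblock.
Qed.

Lemma exists_unitmx_row0 (K : fieldType) n (v : 'rV[K]_n.+1) : v != 0 ->
  exists2 P, P \in unitmx & row 0 P = v.
Proof.
move=> v0; pose R := row_ebase v.
have rk : \rank v = 1%N by rewrite rank_rV v0.
pose c := col_ebase v 0 0.
have vE : v = c *: row 0 R.
  rewrite -[LHS]mulmx_ebase rk -/R [col_ebase v]mx11_scalar mul_scalar_mx -scalemxAl.
  congr (_ *: _); apply/rowP => j; rewrite !mxE (bigD1 ord0) //= big1 => [|i i0].
    by rewrite mxE /= mul1r addr0.
  by rewrite mxE /= (_ : (0%N == i) = false) ?mul0r //; case: i i0 => -[].
have c0 : c != 0 by apply: contraNneq v0 => c0; rewrite vE c0 scale0r.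
exists (c *: R); last by rewrite linearZ.
by rewrite unitmxZ ?unitfE // row_ebase_unit.
Qed.

(** A row eigenvector taken as first basis vector makes the matrix block lower triangular;
    cancelling ['X - z%:P] shows that the characteristic polynomial of the remaining block splits
    too. *)
Lemma split_char_poly_trig (K : fieldType) n (M : 'M[K]_n) (s : seq K) :
    char_poly M = \prod_(z <- s) ('X - z%:P) ->
  exists2 P, P \in unitmx & is_trig_mx (P *m M *m invmx P).
Proof.
elim: n M s => [|n IH] M s sE.
  by exists 1%:M; rewrite ?unitmx1 //; apply/is_trig_mxP => -[].
case: s sE => [|z s] sE.
  by have := size_char_poly M; rewrite sE big_nil size_poly1.
have : root (char_poly M) z by rewrite sE root_prod_XsubC inE eqxx.
rewrite -eigenvalue_root_char => /eigenvalueP[v vM v0].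
have [P Pu Pv] := exists_unitmx_row0 v0.
pose N : 'M_(1 + n) := P *m M *m invmx P.
have rN : row 0 N = z *: delta_mx 0 0.
  rewrite /N !row_mul Pv vM -scalemxAl -Pv -row_mul mulmxV //.
  by rewrite row1.
have NE : N = block_mx z%:M 0 (dlsubmx N) (drsubmx N).
  move: N rN => A rA; rewrite -[LHS]submxK; congr block_mx.
    rewrite [LHS]mx11_scalar; congr _%:M; have := congr1 (fun u : 'rV_n.+1 => u 0 0) rA.
    by rewrite !mxE !eqxx mulr1 => <-; congr (A _ _); apply/val_inj.
  apply/rowP => j; have := congr1 (fun u : 'rV_n.+1 => u 0 (rshift 1 j)) rA.
  by rewrite !mxE /= mulr0 => <-; congr (A _ _); apply/val_inj.
have cN : char_poly (drsubmx N) = \prod_(z <- s) ('X - z%:P).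
  apply: (mulfI (negbT (polyXsubC_eq0 z))).
  rewrite big_cons in sE.
  rewrite -sE -(char_poly_conj M Pu) -/N [in RHS]NE.
  by rewrite (char_poly_lblock (z%:M : 'M_1)) /char_poly det_mx11 !mxE !eqxx.
have [Q Qu Qt] := IH _ _ cN.
pose B : 'M_(1 + n) := block_mx 1%:M 0 0 Q.
pose B' : 'M_(1 + n) := block_mx 1%:M 0 0 (invmx Q).
have BE : B *m B' = 1%:M.
  rewrite mulmx_block !mulmx0 !mul0mx !addr0 add0r mulmx1 mulmxV //.
  by rewrite -scalar_mx_block.
have [Bu _] := mulmx1_unit BE.
have BPu : B *m P \in unitmx by rewrite unitmx_mul Bu.
exists (B *m P) => //.
have -> : invmx (B *m P) = invmx P *m B'.
  apply: (can_inj (mulKmx BPu)).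
  by rewrite mulmxV // -mulmxA (mulmxA P) mulmxV // mul1mx.
have -> : B *m P *m M *m (invmx P *m B') = B *m N *m B' by rewrite /N !mulmxA.
rewrite NE !mulmx_block (@is_trig_block_mx _ 1 n 1 n) //.
rewrite !mulmx0 !mul0mx !addr0 !add0r ?mul0mx ?mulmx0 ?addr0 eqxx.
by rewrite mx11_is_trig.
Qed.

Lemma mulmx_trig (R : pzRingType) n (A B : 'M[R]_n) : is_trig_mx A -> is_trig_mx B ->
  is_trig_mx (A *m B) /\ forall i, (A *m B) i i = A i i * B i i.
Proof.
move=> /is_trig_mxP At /is_trig_mxP Bt; split=> [|i].
  apply/is_trig_mxP => i j lt_ij; rewrite mxE big1 // => k _.
  have [lt_ik|le_ki] := ltnP i k; first by rewrite At // mul0r.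
  by rewrite Bt ?mulr0 // (leq_ltn_trans le_ki).
rewrite mxE (bigD1 i) //= big1 ?addr0 // => k ki.
have [lt_ik|le_ki] := ltnP i k; first by rewrite At // mul0r.
rewrite Bt ?mulr0 // ltn_neqAle le_ki andbT.
by apply: contraNneq ki => /val_inj ->.
Qed.

Lemma horner_mx_trig (R : comNzRingType) n (T : 'M[R]_n.+1) (q : {poly R}) :
    is_trig_mx T ->
  is_trig_mx (horner_mx T q) /\ forall i, horner_mx T q i i = q.[T i i].
Proof.
move=> Tt; elim/poly_ind: q => [|q c [IHt IHd]].
  by rewrite rmorph0; split=> [|i]; rewrite ?mx0_is_trig // mxE horner0.
have [/is_trig_mxP Pt Pd] := mulmx_trig IHt Tt.
rewrite rmorphD rmorphM /= horner_mx_X horner_mx_C; split=> [|i].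
  apply/is_trig_mxP => i j lt_ij; rewrite mxE -/(_ *m _) Pt // add0r mxE.
  by rewrite -(inj_eq val_inj) ltn_eqF.
by rewrite mxE [X in X + _]Pd IHd mxE eqxx hornerMXaddC.
Qed.

Lemma split_mxtrace_horner (K : fieldType) n (M : 'M[K]_n.+1) (s : seq K) :
    char_poly M = \prod_(z <- s) ('X - z%:P) ->
  exists t : 'I_n.+1 -> K, char_poly M = \prod_i ('X - (t i)%:P) /\
    forall q, \tr (horner_mx M q) = \sum_i q.[t i].
Proof.
move=> /split_char_poly_trig[P Pu Tt]; set T := P *m M *m _ in Tt.
exists (fun i => T i i); rewrite -(char_poly_trig Tt) char_poly_conj //; split=> // q.
transitivity (\tr (horner_mx T q)).
  by rewrite horner_mx_uconj // mxtrace_mulC mulKmx.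
by apply: eq_bigr => i _; apply: (horner_mx_trig q Tt).2.
Qed.

(** * Interpolation, generalized eigenspaces and nilpotent derivations *)

Lemma coprimep_exp_XsubC (K : fieldType) (a b : K) k l : a != b ->
  coprimep (('X - a%:P) ^+ k) (('X - b%:P) ^+ l).
Proof.
move=> ab; apply/coprimep_expl/coprimep_expr/coprimep_XsubC2.
by rewrite subr_eq0 eq_sym.
Qed.

(** Chinese remaindering, one node at a time: [u * P] is 0 modulo the old powers and 1 modulo the
    new one, so a multiple of it corrects [f]. Nodes may repeat if their values agree. *)
Lemma poly_interpolation_exp (K : fieldType) N (s : seq (K * K)) :
    {in s &, forall x y, x.1 = y.1 -> x.2 = y.2} ->
  exists f : {poly K}, forall x, x \in s -> ('X - x.1%:P) ^+ N %| f - x.2%:P.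
Proof.
elim: s => [|x s IH] sP; first by exists 0.
have [|f fP] := IH; first by move=> y z ys zs; apply: sP; rewrite inE ?ys ?zs orbT.
have [/mapP[y ys xy]|x_s] := boolP (x.1 \in [seq y.1 | y <- s]).
  exists f => z; rewrite inE => /predU1P[->|/fP//].
  by rewrite xy (sP x y) ?fP // inE ?eqxx // ys orbT.
pose P := \prod_(y <- s) ('X - y.1%:P) ^+ N.
have /Bezout_eq1_coprimepP[[u v] /= uv] : coprimep P (('X - x.1%:P) ^+ N).
  rewrite /P; elim: {IH sP fP P} s x_s => [|y s IH].
    by rewrite big_nil coprime1p.
  rewrite inE big_cons coprimepMl negb_or => /andP[xy /IH ->]; rewrite andbT.
  by apply: coprimep_exp_XsubC; rewrite eq_sym.
exists (f + u * P * (x.2%:P - f)) => z; rewrite inE => /predU1P[->|zs].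
  have -> : f + u * P * (x.2%:P - f) - x.2%:P =
    v * (f - x.2%:P) * ('X - x.1%:P) ^+ N.
    by transitivity ((f - x.2%:P) * (1 - u * P)); [ring | rewrite -uv; ring].
  exact: dvdp_mull.
rewrite addrAC dvdp_addl ?fP // dvdp_mulr // dvdp_mull //.
by rewrite /P (big_rem z) //= dvdp_mulr.
Qed.

(** The generalized eigenspaces span the space, put as an induction principle. By Cayley-Hamilton a
    product of coprime powers [p * q] kills [v]; a Bezout relation splits [v] into a part killed by
    [q], left to the induction over distinct eigenvalues, and a part killed by [p]. *)
Lemma generalized_eigen_ind (K : fieldType) n (M : 'M[K]_n.+1)
    (t : 'I_n.+1 -> K) (P : 'rV[K]_n.+1 -> Prop) :
    char_poly M = \prod_i ('X - (t i)%:P) ->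
    (forall v w, P v -> P w -> P (v + w)) ->
    (forall i v, v *m horner_mx M (('X - (t i)%:P) ^+ n.+1) = 0 -> P v) ->
  forall v, P v.
Proof.
move=> cM PD Peig v; pose r := [seq t i | i <- enum 'I_n.+1].
have r_t z : z \in undup r -> exists i, z = t i.
  by rewrite mem_undup => /mapP[i _ ->]; exists i.
have hM a b : horner_mx M (a * b) = horner_mx M a *m horner_mx M b by rewrite rmorphM.
have := Cayley_Hamilton M; rewrite cM => /(congr1 (mulmx v)); rewrite mulmx0.
have -> : \prod_i ('X - (t i)%:P) = \prod_(z <- undup r) ('X - z%:P) ^+ count_mem z r.
  by rewrite prodr_undup_exp_count big_map big_enum.
elim: (undup r) (undup_uniq r) r_t v => [_ _|z u IH] /=.
  move=> v; rewrite big_nil rmorph1 mulmx1 => ->.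
  by apply: (Peig ord0); rewrite mul0mx.
case/andP=> zu uniq_u u_t v; rewrite big_cons => v0.
set p := _ ^+ _ in v0; set q := \prod_(_ <- _) _ in v0.
have /Bezout_eq1_coprimepP[[a b] /= ab] : coprimep p q.
  rewrite /p /q; elim: {IH uniq_u u_t v0 q} u zu => [|y u IH].
    by rewrite big_nil coprimep1.
  rewrite inE big_cons coprimepMr negb_or => /andP[zy /IH ->]; rewrite andbT.
  exact: coprimep_exp_XsubC.
have -> : v = v *m horner_mx M (a * p) + v *m horner_mx M (b * q).
  by rewrite -mulmxDr -rmorphD ab rmorph1 mulmx1.
apply: PD.
  apply: IH => // [y yu|]; first by apply: u_t; rewrite inE yu orbT.
  rewrite -mulmxA -hM.
  by rewrite (_ : a * p * q = p * q * a) ?(hM (p * q)) ?mulmxA ?v0 ?mul0mx //=; ring.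
have [i zi] := u_t z (mem_head _ _); apply: (Peig i); rewrite -zi.
have le : (count_mem z r <= n.+1)%N.
  by rewrite (leq_trans (count_size _ _)) // size_map size_enum_ord.
pose e := ('X - z%:P) ^+ (n.+1 - count_mem z r).
have -> : ('X - z%:P) ^+ n.+1 = e * p by rewrite -exprD subnK.
rewrite -mulmxA -hM.
rewrite (_ : b * q * (e * p) = p * q * (b * e)); last by ring.
by rewrite hM mulmxA v0 mul0mx.
Qed.

(* [A v] is the matrix of [w |-> [v, w]] acting on row vectors, and [M] is a
   derivation of this bracket. *)
Lemma generalized_eigen_bracket (K : fieldType) n
    (A : {linear 'rV[K]_n.+1 -> 'M[K]_n.+1}) (M : 'M[K]_n.+1) (x y : K) a b
    (v w : 'rV[K]_n.+1) :
    (forall v, A (v *m M) = A v *m M - M *m A v) ->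
    v *m horner_mx M (('X - x%:P) ^+ a) = 0 ->
    w *m horner_mx M (('X - y%:P) ^+ b) = 0 ->
  w *m A v *m horner_mx M (('X - (x + y)%:P) ^+ (a + b)) = 0.
Proof.
move=> derM; have hX z k (u : 'rV_n.+1) : u *m horner_mx M (('X - z%:P) ^+ k.+1) =
    (u *m M - z *: u) *m horner_mx M (('X - z%:P) ^+ k).
  rewrite exprS rmorphM mulmxA rmorphB /= horner_mx_X horner_mx_C.
  by rewrite mulmxBr mul_mx_scalar.
move: {2}(a + b)%N (erefl (a + b)%N) => c.
elim: c a b v w => [|c IH] [|a] [|b] v w // abc.
- by rewrite !expr0 rmorph1 !mulmx1 => -> ->; rewrite mul0mx.
- by rewrite expr0 rmorph1 mulmx1 => -> _; rewrite raddf0 mulmx0 mul0mx.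
- by rewrite [_ ^+ 0]expr0 rmorph1 mulmx1 => _ ->; rewrite !mul0mx.
move=> va wb; rewrite addSn hX.
(* The derivation rule gives (M - x - y)[v, w] = [(M - x)v, w] + [v, (M - y)w], and each term lowers
   one exponent. *)
have -> : w *m A v *m M - (x + y) *: (w *m A v) =
    w *m A (v *m M - x *: v) + (w *m M - y *: w) *m A v.
  rewrite raddfB /= derM [A (_ *: _)]linearZ /= !mulmxBr mulmxBl !mulmxA -scalemxAl.
  by rewrite -scalemxAr scalerDl opprD [RHS]addrACA subrK.
rewrite [LHS]mulmxDl IH ?add0r -?hX //; last by move: abc; rewrite addSn => -[].
by rewrite addnS -addSn IH -?hX //; move: abc; rewrite addnS => -[].
Qed.

Lemma split_derivation_nilpotent (K : fieldType) (K0 : [pchar K] =i pred0) n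
    (A : {linear 'rV[K]_n.+1 -> 'M[K]_n.+1}) (M : 'M[K]_n.+1) (s : seq K) :
    (forall v, A (v *m M) = A v *m M - M *m A v) ->
    (forall d, (forall v, A (v *m d) = A v *m d - d *m A v) -> \tr (M *m d) = 0) ->
    char_poly M = \prod_(z <- s) ('X - z%:P) ->
  M ^+ n.+1 = 0.
Proof.
move=> derM trM /split_mxtrace_horner[t [cM tr_h]].
have [t0|[i0 ti0]] : (forall i, t i = 0) \/ exists i0, t i0 != 0.
  have [ex|nex] := classic (exists i0, t i0 != 0); [by right | left=> i].
  by apply/eqP/negPn/negP => ti; apply: nex; exists i.
  have := Cayley_Hamilton M; rewrite cM (eq_bigr (fun=> 'X)) => [|i _].
    by rewrite prodr_const card_ord rmorphXn /= horner_mx_X.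
  by rewrite t0 subr0.
have [c [ci0 cP]] := rat_functional K0 ti0.
(* [q] stands for a formal rational combination of eigenvalues, [tau q] for its value in [K] and
   [gam q] for its image under [c]; [gam_tau] says that [c] is well defined on the span. *)
pose tau (q : 'rV[rat]_n.+1) := \sum_i ratr (q 0 i) * t i.
pose gam (q : 'rV[rat]_n.+1) := \sum_i q 0 i * c i.
have K0D := char0_ratrD K0.
have gam_tau q q' : tau q = tau q' -> gam q = gam q'.
  move=> tauE; apply/eqP; rewrite -subr_eq0 -sumrB; apply/eqP.
  rewrite (eq_bigr (fun i => (q 0 i - q' 0 i) * c i)) => [|i _]; last by rewrite mulrBl.
  apply: cP; apply/eqP.
  rewrite (eq_bigr (fun i => ratr (q 0 i) * t i - ratr (q' 0 i) * t i)).
    by rewrite sumrB -/(tau q) tauE subrr.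
  move=> i _; rewrite -mulrBl; congr (_ * _); apply/eqP.
  by rewrite eq_sym subr_eq -K0D subrK.
pose e i : 'rV[rat]_n.+1 := delta_mx 0 i.
have tau_e i : tau (e i) = t i.
  rewrite /tau (bigD1 i) //= big1 => [|j ne].
    by rewrite mxE !eqxx ratr_nat mul1r addr0.
  by rewrite mxE (negPf ne) andbF ratr_nat mul0r.
have gam_e i : gam (e i) = c i.
  rewrite /gam (bigD1 i) //= big1 => [|j ne]; first by rewrite mxE !eqxx mul1r addr0.
  by rewrite mxE (negPf ne) andbF mul0r.
have tauD q q' : tau (q + q') = tau q + tau q'.
  by rewrite -big_split; apply: eq_bigr => i _; rewrite mxE K0D mulrDl.
have gamD q q' : gam (q + q') = gam q + gam q'.
  by rewrite -big_split; apply: eq_bigr => i _; rewrite mxE mulrDl.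
(* Sums [t i + t j] are nodes as well, since brackets of generalized eigenvectors belong to them;
   such a bracket is killed by the power [n.+1 + n.+1], hence this exponent. *)
pose qs := [seq e i | i <- enum 'I_n.+1] ++
  [seq e i + e j | i <- enum 'I_n.+1, j <- enum 'I_n.+1].
have [|f fP] := @poly_interpolation_exp K (n.+1 + n.+1)
    [seq (tau q, ratr (gam q)) | q <- qs].
  by move=> _ _ /mapP[q _ ->] /mapP[q' _ ->] /= /gam_tau ->.
have fe i : ('X - (t i)%:P) ^+ (n.+1 + n.+1) %| f - (ratr (c i))%:P.
  have := fP (tau (e i), ratr (gam (e i))); rewrite tau_e gam_e; apply.
  rewrite -tau_e -gam_e; apply: (map_f (fun q => (tau q, ratr (gam q)))).
  by rewrite mem_cat map_f ?mem_enum.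
have fee i j : ('X - (t i + t j)%:P) ^+ (n.+1 + n.+1) %| f - (ratr (c i) + ratr (c j))%:P.
  have := fP (tau (e i + e j), ratr (gam (e i + e j))).
  rewrite tauD gamD !tau_e !gam_e K0D; apply.
  rewrite -!tau_e -!gam_e -tauD -K0D -gamD.
  apply: (map_f (fun q => (tau q, ratr (gam q)))).
  by rewrite mem_cat orbC (allpairs_f (fun i j => e i + e j)) ?mem_enum.
pose d := horner_mx M f.
have eig z a k (v : 'rV[K]_n.+1) : ('X - z%:P) ^+ (n.+1 + n.+1) %| f - a%:P ->
    (k <= n.+1 + n.+1)%N ->
    v *m horner_mx M (('X - z%:P) ^+ k) = 0 -> v *m d = a *: v.
  case/dvdpP=> g /eqP; rewrite subr_eq => /eqP fE le v0.
  have -> : d = horner_mx M (('X - z%:P) ^+ k) *m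
      horner_mx M (g * ('X - z%:P) ^+ (n.+1 + n.+1 - k)) + a%:M.
    rewrite /d fE rmorphD /= horner_mx_C; congr (_ + _).
    by rewrite -{1}(subnKC le) exprD mulrCA rmorphM.
  by rewrite mulmxDr mulmxA v0 mul0mx add0r mul_mx_scalar.
(* By linearity it is enough to take generalized eigenvectors [v] and [w], for [t i] and [t k]: then
   [d] multiplies them by [c i] and [c k], and their bracket by the sum. *)
have derd v : A (v *m d) = A v *m d - d *m A v.
  apply/row_matrixP=> j; rewrite !rowE; move: (delta_mx 0 j) => w.
  pattern v; apply: (generalized_eigen_ind cM) v => [v v' /= IHv IHv'|i v /= vi].
    rewrite mulmxDl !(raddfD A) [LHS]mulmxDr IHv IHv' -mulmxDr.
    by congr (_ *m _); rewrite mulmxDl mulmxDr opprD addrACA.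
  pattern w; apply: (generalized_eigen_ind cM) w => [w w' /= IHw IHw'|k w /= wk].
    by rewrite !mulmxDl IHw IHw'.
  rewrite (eig _ _ _ _ (fe i) _ vi) ?leq_addr // mulmxBr !mulmxA.
  rewrite (eig _ _ _ _ (fe k) _ wk) ?leq_addr //.
  rewrite (eig _ _ _ (w *m A v) (fee i k) (leqnn _)).
    by rewrite linearZ /= -scalemxAr -scalemxAl scalerDl addrK.
  exact: generalized_eigen_bracket.
have := trM d derd.
have -> : M *m d = horner_mx M ('X * f) by rewrite rmorphM /= horner_mx_X.
rewrite tr_h => tr0.
have fc i : f.[t i] = ratr (c i).
  have /dvdpP[g /eqP] := fe i; rewrite subr_eq => /eqP ->.
  by rewrite !hornerE subrr expr0n mulr0 add0r.
(* The vanishing trace is a rational relation among the [t i] with coefficients [c i], so [c]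
   preserves it. *)
have : \sum_i c i * c i = 0.
  apply: cP; rewrite -[RHS]tr0; apply: eq_bigr => i _.
  by rewrite !hornerE fc mulrC.
move/eqP; rewrite psumr_eq0 => [/allP/(_ i0)|i _]; last by rewrite -expr2 sqr_ge0.
by rewrite mem_index_enum /= mulf_eq0 orbb (negPf ci0) => /(_ isT).
Qed.

(** * Bracket identities and Engel's theorem *)

Section LieAlgebra.
Variables (F : fieldType) (L : findimLieAlgType F).
Implicit Types (x y z u w : L) (H U W : {vspace L}).

Lemma lie_linear x : linear (lie_bracket x).
Proof. exact: (@lie_bilinear F L).2. Qed.

HB.instance Definition _ x :=
  GRing.isLinear.Build F L L _ (lie_bracket x) (lie_linear x).

Lemma lieDl x y z : [lie x + y, z] = [lie x, z] + [lie y, z].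
Proof. by rewrite -[x]scale1r (lie_bilinear.1 z 1 x y) /= !scale1r. Qed.

Lemma lieC x y : [lie x, y] = - [lie y, x].
Proof.
apply/eqP; rewrite -addr_eq0; apply/eqP.
have := lie_alternating (x + y).
by rewrite lieDl !raddfD /= !lie_alternating add0r addr0.
Qed.

Lemma lie0l x : [lie 0, x] = 0.
Proof. by rewrite lieC raddf0 oppr0. Qed.

Lemma lieZl a x y : [lie a *: x, y] = a *: [lie x, y].
Proof. by rewrite lieC linearZ /= -scalerN -lieC. Qed.

Lemma lieNl x y : [lie - x, y] = - [lie x, y].
Proof. by rewrite -scaleN1r lieZl scaleN1r. Qed.

Lemma lieBl x y z : [lie x - y, z] = [lie x, z] - [lie y, z].
Proof. by rewrite lieDl lieNl. Qed.

Lemma lie_leibniz x y z : [lie x, [lie y, z]] = [lie [lie x, y], z] + [lie y, [lie x, z]].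
Proof.
apply/eqP; rewrite -subr_eq0 opprD addrA -(lie_jacobi x y z).
by rewrite (lieC [lie x, y] z) opprK [[lie z, x]]lieC raddfN /= addrAC.
Qed.

(* Quantifying over pairs [U], [W] avoids quotient modules: [U = H], [W = L] gives
   an element outside [H] that normalizes [H], and [U = 0], [W = L] Engel's theorem. *)
Let common_kernel H := forall U W,
  (forall x u, x \in H -> u \in U -> [lie x, u] \in U) ->
  (forall x w, x \in H -> w \in W -> [lie x, w] \in W) ->
  ~~ (W <= U)%VS ->
  exists w, [/\ w \in W, w \notin U & forall x, x \in H -> [lie x, w] \in U].

(** A subalgebra [H] with the common kernel property is enlarged one dimension at a time, from 0 to
    [L], by an element [x] that normalizes it. To pass the property to the sum of [H] and the line
    of [x], apply [ad x] repeatedly to a vector that serves for [H], and keep the last iterate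
    outside [U]. *)
Lemma engel_center x0 : x0 != 0 ->
    (forall x, exists k, forall y, iter k (lie_bracket x) y = 0) ->
  exists2 w, w != 0 & forall x, [lie x, w] = 0.
Proof.
move=> x0_neq0 nilp; suff ker : common_kernel fullv.
  have [|||w [_ w0 wC]] := (ker : forall U W, _ -> _ -> _ -> _) 0%VS fullv.
  - by move=> x u _; rewrite !memv0 => /eqP->; rewrite raddf0.
  - by move=> x u _ _; apply: memvf.
  - by apply: contra x0_neq0 => /subvP/(_ _ (memvf x0)); rewrite memv0.
  exists w; first by rewrite -memv0.
  by move=> x; apply/eqP; rewrite -memv0 wC ?memvf.
suff step k H : (\dim {:L} - \dim H <= k)%N ->
    (forall x y, x \in H -> y \in H -> [lie x, y] \in H) ->
    common_kernel H -> common_kernel fullv.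
  apply: (step _ 0%VS (leqnn _)) => [x y|U W _ _ /subvPn[w wW wU]].
    by rewrite !memv0 => /eqP-> _; rewrite lie0l.
  exists w; split=> // x; rewrite memv0 => /eqP->.
  by rewrite lie0l mem0v.
elim: k H => [|k IH] H le_k algH kerH.
  suff -> : fullv = H by [].
  by apply/esym/eqP; rewrite eqEdim subvf /= -subn_eq0 -leqn0.
have [/eqP HE|nH] := boolP (H == fullv); first by rewrite -HE.
have [x [_ xH Hx]] :
    exists w, [/\ w \in fullv, w \notin H & forall x, x \in H -> [lie x, w] \in H].
  apply: kerH => // [? ? _ _|]; first exact: memvf.
  by apply: contraNN nH => LH; rewrite eqEsubv subvf.
have xH' h : h \in H -> [lie x, h] \in H by move=> hH; rewrite lieC memvN Hx.
apply: (IH (H + <[x]>)%VS).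
- have lt : (\dim H < \dim (H + <[x]>))%N.
    rewrite (ltn_leqif (dimv_leqif_eq (addvSl _ _))); apply/eqP => HE.
    by case/negP: xH; rewrite HE memvE addvSr.
  rewrite -ltnS (leq_trans _ le_k) // ltn_sub2l // (leq_trans lt) //.
  by rewrite dimvS ?subvf.
- move=> _ _ /memv_addP[h hH [_ /vlineP[a ->] ->]]
    /memv_addP[h' hH' [_ /vlineP[b ->] ->]].
  rewrite lieDl !raddfD /= !linearZ /= !lieZl lie_alternating !scaler0 addr0.
  apply: (subvP (addvSl _ _)).
  by rewrite !rpredD ?rpredZ ?Hx ?xH' ?algH.
move=> U W HU HW WU.
have sH h : h \in H -> h \in (H + <[x]>)%VS by move=> hH; rewrite (subvP (addvSl _ _)).
have sx : x \in (H + <[x]>)%VS by rewrite memvE addvSr.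
have [||w0 [w0W w0U Hw0]] := kerH U W _ _ WU; first by move=> *; rewrite HU ?sH.
  by move=> *; rewrite HW ?sH.
pose w i := iter i (lie_bracket x) w0.
(* For [h] in [H], [h, [x, w]] = [[h, x], w] + [x, [h, w]] with [h, x] in [H], so the iterates keep
   the property. *)
have wP i : w i \in W /\ forall h, h \in H -> [lie h, w i] \in U.
  elim: i => [//|i [wiW Hwi]]; split=> [|h hH]; first by rewrite HW.
  by rewrite [w _]/= lie_leibniz rpredD ?Hwi ?Hx // HU ?Hwi.
have [k0 wk0] := nilp x.
have exU : exists i, w i \in U by exists k0; rewrite /w wk0 mem0v.
case: (ex_minnP exU) => -[|i] wU imin; first by case/negP: w0U.
exists (w i); split; first exact: (wP i).1.
  by apply/negP => /imin; rewrite ltnn.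
move=> _ /memv_addP[h hH [_ /vlineP[a ->] ->]].
by rewrite lieDl lieZl rpredD ?rpredZ // (wP i).2.
Qed.

(** * Consequences of simplicity *)

Hypothesis simpleL : lie_simple L.

Lemma simple_lie_ideal (P : L -> Prop) : P 0 ->
    (forall a x y, P x -> P y -> P (a *: x + y)) ->
    (forall x y, P y -> P [lie x, y]) ->
  (forall x, P x -> x = 0) \/ (forall x, P x).
Proof.
move=> P0 Plin Pid; have [U UP] := vspace_of_pred P0 Plin.
have [|U0|U1] := simpleL.2 U; first by move=> x y /UP Py; apply/UP/Pid.
  by left=> x /UP; rewrite U0 memv0 => /eqP.
by right=> x; apply/UP; rewrite U1 memvf.
Qed.

(** The center is an ideal, and it is not [L] because [L] is not abelian. *)
Lemma simple_lie_center x : (forall y, [lie x, y] = 0) -> x = 0.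
Proof.
have [|a y z yC zC w|y z zC w|H|H] :=
  @simple_lie_ideal (fun x => forall y, [lie x, y] = 0).
- by move=> y; rewrite lie0l.
- by rewrite lieDl lieZl yC zC scaler0 addr0.
- have Cz u : [lie u, z] = 0 by rewrite lieC zC oppr0.
  by rewrite lieC lie_leibniz !Cz raddf0 addr0 oppr0.
- exact: H.
by case: simpleL.1.
Qed.

(** This is [L, L] = L as an induction principle: [P] contains all brackets, hence is an ideal, and
    it is nonzero since [L] is not abelian. *)
Lemma simple_lie_perfect (P : L -> Prop) : P 0 ->
    (forall a x y, P x -> P y -> P (a *: x + y)) ->
    (forall x y, P [lie x, y]) ->
  forall x, P x.
Proof.
move=> P0 Plin Pbr; have [//|//|x y _|H|//] := @simple_lie_ideal P; first exact: Pbr.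
by case: simpleL.1 => x y; apply: H.
Qed.

Lemma simple_lie_not_ad_nilpotent :
  ~ (forall x, exists k, forall y, iter k (lie_bracket x) y = 0).
Proof.
have [[x x0]|L0] := classic (exists x : L, x != 0).
  case/(engel_center x0) => w /eqP w0 wC; apply/w0/simple_lie_center => y.
  by rewrite lieC wC oppr0.
case: simpleL.1 => x y; apply/eqP/negPn/negP => xy; apply: L0.
by exists [lie x, y].
Qed.

(** * Adjoint matrices and the Killing form *)

Section Coordinates.
Variables (n : nat) (rho : {linear L -> 'rV[F]_n}) (rho' : 'rV[F]_n -> L).
Hypotheses (rhoK : cancel rho rho') (rho'K : cancel rho' rho).

(** The matrix acts on row vectors from the right, so composition reverses products, as in
    [ad_mx_lie]. *)
Definition ad_mx x : 'M[F]_n := \matrix_i rho [lie x, rho' (delta_mx 0 i)].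

Lemma coord_sum x : x = \sum_j rho x 0 j *: rho' (delta_mx 0 j).
Proof.
apply: (can_inj rhoK); rewrite [LHS]row_sum_delta linear_sum.
by apply: eq_bigr => i _; rewrite linearZ /= rho'K.
Qed.

Lemma mul_ad_mx x y : rho y *m ad_mx x = rho [lie x, y].
Proof.
rewrite [in RHS](coord_sum y) mulmx_sum_row !linear_sum; apply: eq_bigr => i _.
by rewrite rowK !linearZ.
Qed.

Lemma ad_mx_ext (A B : 'M[F]_n) : (forall z, rho z *m A = rho z *m B) -> A = B.
Proof. by move=> AB; apply/row_matrixP => i; rewrite !rowE -(rho'K (delta_mx 0 i)). Qed.

Lemma ad_mx_is_linear : linear ad_mx.
Proof.
move=> a x y; apply: ad_mx_ext => z.
by rewrite mulmxDr -scalemxAr !mul_ad_mx lieDl lieZl linearP.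
Qed.

HB.instance Definition _ := GRing.isLinear.Build F L 'M[F]_n _ ad_mx ad_mx_is_linear.

Lemma ad_mx0 : ad_mx 0 = 0.
Proof. exact: linear0. Qed.

Lemma ad_mx_lie x y : ad_mx [lie x, y] = ad_mx y *m ad_mx x - ad_mx x *m ad_mx y.
Proof.
apply: ad_mx_ext => z; rewrite mulmxBr !mulmxA !mul_ad_mx -raddfB /=.
by rewrite [in RHS]lie_leibniz addrK.
Qed.

Definition killing x y := \tr (ad_mx x *m ad_mx y).

Lemma killingC x y : killing x y = killing y x.
Proof. exact: mxtrace_mulC. Qed.

Lemma killing_is_linear x : scalar (killing x).
Proof.
by move=> a y z; rewrite /killing linearP mulmxDr -scalemxAr mxtraceD mxtraceZ.
Qed.

Lemma killing_lie x y z : killing [lie x, y] z = killing x [lie y, z].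
Proof.
rewrite /killing !ad_mx_lie mulmxBl mulmxBr !raddfB /= -!mulmxA.
by congr (_ - _); rewrite mxtrace_mulC -mulmxA.
Qed.

End Coordinates.

(** * Nondegeneracy of the Killing form *)

Section Killing.
Variables (charF0 : [pchar F] =i pred0) (n : nat).
Variables (rho : {linear L -> 'rV[F]_n.+1}) (rho' : 'rV[F]_n.+1 -> L).
Hypotheses (rhoK : cancel rho rho') (rho'K : cancel rho' rho).

Local Notation ad := (ad_mx rho rho').

Lemma killing0_ad_nilpotent x :
  (forall y z, killing rho rho' y z = 0) -> ad x ^+ n.+1 = 0.
Proof.
move=> kill0; have [K [f [s sE]]] := exists_splitting_field (char_poly_monic (ad x)).
have K0 : [pchar K] =i pred0 by move=> p; rewrite (fmorph_pchar f) charF0.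
pose e j := rho' (delta_mx 0 j).
(* The adjoint representation with scalars extended to [K]. A derivation [d] over [K] can move
   vectors of [L] out of [L], so [trA] is needed for every [v] over [K]. *)
pose A (w : 'rV[K]_n.+1) := \sum_j w 0 j *: map_mx f (ad (e j)).
have A_lin : linear A.
  move=> a v w; rewrite scaler_sumr -big_split; apply: eq_bigr => j _.
  by rewrite !mxE scalerDl scalerA.
pose AL := GRing.isLinear.Build _ _ _ _ A A_lin.
pose A' : {linear 'rV[K]_n.+1 -> 'M[K]_n.+1} := HB.pack A AL.
have A_map y : A (map_mx f (rho y)) = map_mx f (ad y).
  rewrite [in RHS](coord_sum rhoK rho'K y) linear_sum raddf_sum.
  by apply: eq_bigr => j _; rewrite linearZ /= map_mxZ mxE.
have der y v : A (v *m map_mx f (ad y)) =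
    A v *m map_mx f (ad y) - map_mx f (ad y) *m A v.
  transitivity (\sum_j v 0 j *: map_mx f (ad [lie y, e j])).
    rewrite {1}[v]row_sum_delta mulmx_suml -[A]/(A' : _ -> _) linear_sum.
    apply: eq_bigr => j _; rewrite -scalemxAl linearZ /= -[in RHS]A_map -(mul_ad_mx rhoK rho'K) map_mxM.
    by rewrite /e rho'K map_delta_mx.
  rewrite /A mulmx_suml mulmx_sumr -sumrB; apply: eq_bigr => j _.
  by rewrite (ad_mx_lie rhoK rho'K) map_mxB !map_mxM scalerBr -scalemxAl -scalemxAr.
have trA y (v : 'rV[K]_n.+1) : \tr (map_mx f (ad y) *m A v) = 0.
  rewrite /A mulmx_sumr raddf_sum big1 // => j _.
  rewrite -scalemxAr /= mxtraceZ -map_mxM trace_map_mx.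
  by have := kill0 y (e j); rewrite /killing => ->; rewrite rmorph0 mulr0.
have tr0 d : (forall v, A (v *m d) = A v *m d - d *m A v) ->
    forall y, \tr (map_mx f (ad y) *m d) = 0.
  move=> derd; apply: simple_lie_perfect => [|a y z y0 z0|y z].
  - by rewrite (ad_mx0 rhoK rho'K) map_mx0 mul0mx mxtrace0.
  - rewrite (ad_mx_is_linear rhoK rho'K) map_mxD map_mxZ mulmxDl -scalemxAl.
    by rewrite mxtraceD mxtraceZ y0 z0 mulr0 addr0.
  (* Cyclicity of the trace and the derivation rule turn tr(ad [y, z] d) into -tr(ad y A(z d)),
     which is 0 by [trA]. *)
  rewrite (ad_mx_lie rhoK rho'K) map_mxB !map_mxM mulmxBl raddfB /= -!mulmxA mxtrace_mulC.
  rewrite -mulmxA -raddfB -mulmxBr -opprB -(A_map z) -derd.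
  by rewrite mulmxN raddfN /= trA oppr0.
have := @split_derivation_nilpotent K K0 n A' (map_mx f (ad x)) s (der x).
rewrite -map_char_poly => /(_ (fun d derd => tr0 d derd x) sE).
rewrite -rmorphXn => /eqP; rewrite map_mx_eq0.
by move/eqP.
Qed.

(** The radical of the form is an ideal; were it [L], the form would vanish and every [ad u] would
    be nilpotent, against Engel's theorem. *)
Lemma killing_nondegenerate x : (forall y, killing rho rho' x y = 0) -> x = 0.
Proof.
have lin y : scalar (killing rho rho' y) by apply: killing_is_linear.
have [y|a u v u0 v0 y|u v v0 y|H|kill0] :=
  @simple_lie_ideal (fun x => forall y, killing rho rho' x y = 0).
- by rewrite killingC -(subrr y) -scaleN1r addrC lin mulN1r addNr.
- by rewrite killingC lin !(killingC _ _ y) u0 v0 mulr0 addr0.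
- by rewrite killing_lie // killingC killing_lie // lieC.
- exact: H.
case: simple_lie_not_ad_nilpotent => u; exists n.+1 => v.
have adE k : rho v *m ad u ^+ k = rho (iter k (lie_bracket u) v).
  elim: k => [|k IH]; first by rewrite expr0 mulmx1.
  by rewrite exprSr mulmxA IH mul_ad_mx.
by apply: (can_inj rhoK); rewrite -adE killing0_ad_nilpotent // mulmx0 linear0.
Qed.

End Killing.
End LieAlgebra.

(** * The invariant form and Lie-orthogonal operators *)

Lemma simple_lie_coordinates (F : fieldType) (L : findimLieAlgType F) :
    lie_simple L ->
  exists n (rho : {linear L -> 'rV[F]_n.+1}) rho', cancel rho rho' /\ cancel rho' rho.
Proof.
move=> simpleL; have [n [rho [rho' [rhoK rho'K]]]] :
    exists n (rho : {linear L -> 'rV[F]_n}) rho', cancel rho rho' /\ cancel rho' rho.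
  pose rho (v : L) := \row_i coord (vbasis {:L}) i v.
  have rho_lin : linear rho by move=> a u v; apply/rowP => i; rewrite !mxE linearP.
  pose rhoL := GRing.isLinear.Build _ _ _ _ rho rho_lin.
  exists _, (HB.pack rho rhoL : {linear L -> _}),
    (fun r : 'rV_(\dim {:L}) => \sum_i r 0 i *: (vbasis {:L})`_i).
  split=> [v|r] /=.
    rewrite [RHS](coord_vbasis (memvf v)).
    by apply: eq_bigr => i _; rewrite mxE.
  by apply/rowP => i; rewrite mxE coord_sum_free // (basis_free (vbasisP _)).
(* Dimension 0 would make [L] abelian; a successor dimension gives the ring of square matrices used
   for the Killing form. *)
case: n => [|n] in rho rho' rhoK rho'K *; last by exists n, rho, rho'.
by case: simpleL.1 => x y; apply: (can_inj rhoK); rewrite [LHS]thinmx0 [RHS]thinmx0.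
Qed.

Lemma simple_lie_invariant_form (F : fieldType) (charF0 : [pchar F] =i pred0)
    (L : findimLieAlgType F) : lie_simple L ->
  exists B : L -> {scalar L},
    (forall x y z, B [lie x, y] z = B x [lie y, z]) /\
    forall x, (forall y, B y x = 0) -> x = 0.
Proof.
move=> simpleL; have [n [rho [rho' [rhoK rho'K]]]] := simple_lie_coordinates simpleL.
pose killL x :=
  GRing.isLinear.Build F L F _ (killing rho rho' x) (killing_is_linear rhoK rho'K x).
exists (fun x => HB.pack (killing rho rho' x) (killL x) : {scalar L}).
split=> [x y z|x Bx]; first exact: (killing_lie rhoK rho'K).
apply: (killing_nondegenerate simpleL charF0 rhoK rho'K) => y.
rewrite killingC; exact: Bx.
Qed.

Lemma lie_orthogonal_involutive (F : fieldType) (charF0 : [pchar F] =i pred0)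
    (L : findimLieAlgType F) (J : 'End(L)) :
  lie_simple L -> lie_orthogonal J -> forall x, J (J x) = x.
Proof.
move=> simpleL orthJ; have [B [Binv Bnd]] := simple_lie_invariant_form charF0 simpleL.
have Jsurj y : exists x, y = J x.
  have kerJ : lker J == 0%VS.
    apply/lker0P => x x' Jxx'; apply/eqP; rewrite -subr_eq0; apply/eqP.
    apply: (simple_lie_center simpleL) => z.
    by rewrite -orthJ linearB /= Jxx' subrr lie0l.
  have : y \in limg J by rewrite lker0_limgf // memvf.
  by case/memv_imgP=> x _ ->; exists x.
pose tau x y z := B x [lie y, z].
have tau23 x y z : tau x (J y) (J z) = tau x y z by rewrite /tau orthJ.
have tau12 x y z : tau (J x) (J y) z = tau x y z by rewrite /tau -!Binv orthJ.
have tauC x y z : tau x y z = - tau x z y by rewrite /tau lieC raddfN.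
(* Exchanging the last two slots costs a sign, which cancels on the way back. *)
have tau13 x y z : tau (J x) y (J z) = tau x y z.
  by rewrite tauC tau12 -tauC.
move=> u; apply/eqP; rewrite -subr_eq0; apply/eqP.
apply: (simple_lie_center simpleL) => z0; have [z ->] := Jsurj z0.
apply: Bnd => x0; have [x ->] := Jsurj x0.
rewrite lieBl raddfB -[LHS]/(tau (J x) (J (J u)) (J z) - tau (J x) u (J z)).
by rewrite tau12 tau13 tau23 subrr.
Qed.

Theorem theorem2 (F : fieldType) (charF0 : [pchar F] =i pred0)
    (L : findimLieAlgType F) (simpleL : lie_simple L) (J : 'End(L)) :
  lie_orthogonal J <-> J = \1%VF \/ J = - \1%VF.
Proof.
split=> [orthJ|[->|->] x y]; last 2 first.
- by rewrite !id_lfunE.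
- by rewrite !opp_lfunE !id_lfunE lieNl raddfN /= opprK.
have JJ := lie_orthogonal_involutive charF0 simpleL orthJ.
have two0 : 2%:R != 0 :> F by have /pcharf0P -> := charF0.
have J_fixed_perp y t : J y = y -> J t = - t -> [lie y, t] = 0.
  move=> Jy Jt; apply/eqP; have := orthJ y t; rewrite Jy Jt raddfN /= => /eqP.
  rewrite eq_sym -addr_eq0 -mulr2n -scaler_nat scaler_eq0 (negPf two0) //.
have [|a x y Jx Jy|x y Jy|fix0|fixJ] := @simple_lie_ideal F L simpleL (fun x => J x = x).
- exact: linear0.
- by rewrite linearP /= Jx Jy.
- apply/eqP; rewrite -subr_eq0; apply/eqP; apply: (simple_lie_center simpleL) => z.
  (* As J^2 = 1, orthogonality moves [J] across the bracket. It remains to show that [x, y] commutes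
     with [t = J z - z], which [J] negates. *)
  have -> : [lie J [lie x, y] - [lie x, y], z] = [lie [lie x, y], J z - z].
    by rewrite lieBl raddfB /= -orthJ JJ.
  pose t := J z - z; have Jt : J t = - t by rewrite /t linearB /= JJ opprB.
  have yt : [lie y, t] = 0 by apply: J_fixed_perp.
  have Jm : J (x - J x) = - (x - J x) by rewrite linearB /= JJ opprB.
  (* Here [x, t] = [J x, J t] = -[J x, t]. Since [y] commutes with both [x - J x] and [t], it
     commutes with their bracket, hence with [x, t]; the Leibniz rule then gives [[x, y], t] = 0. *)
  have xt : [lie x - J x, t] = 2%:R *: [lie x, t].
    by rewrite lieBl scaler_nat mulr2n -[in X in _ = _ + X]orthJ Jt raddfN /=.
  have : [lie y, [lie x - J x, t]] = 0.
    by rewrite lie_leibniz yt raddf0 addr0 (J_fixed_perp y (x - J x)) // lie0l.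
  rewrite xt linearZ /= => /eqP; rewrite scaler_eq0 (negPf two0) /= => /eqP yxt.
  by have := lie_leibniz x y t; rewrite yt raddf0 yxt addr0.
- right; apply/lfunP => x; rewrite opp_lfunE id_lfunE.
  apply/eqP; rewrite -addr_eq0; apply/eqP.
  (* [x + J x] is fixed by [J], hence zero. *)
  by apply: fix0; rewrite linearD /= JJ addrC.
by left; apply/lfunP => x; rewrite id_lfunE.
Qed.
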